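(* The derivability problem for the calculus $\boldsymbol{!}_\mathbf{b}\mathbf{L}^{\mathbf{1}}$ is undecidable: there is no algorithm that, given an arbitrary sequent $\Pi \to A$ of $\boldsymbol{!}_\mathbf{b}\mathbf{L}^{\mathbf{1}}$, decides whether this sequent is derivable in $\boldsymbol{!}_\mathbf{b}\mathbf{L}^{\mathbf{1}}$.
   Context: The calculus $\boldsymbol{!}_\mathbf{b}\mathbf{L}^{\mathbf{1}}$ (Lambek calculus with unit, brackets and a subexponential, after Morrill and Valentín). Formulae are built from primitive types (variables) $p_1,p_2,\dots$ and the constant $\mathbf{1}$ using binary connectives $\backslash$, $/$, $\cdot$ and unary connectives $\langle\rangle$, $[]^{-1}$, $!$. Meta-formulae are finite (possibly empty) sequences whose elements are formulae or bracketed meta-formulae $[\Pi]$; the empty meta-formula is $\Lambda$, and comma denotes concatenation. $\Delta(\Gamma)$ denotes a meta-formula $\Delta$ with a designated occurrence of a meta-formula $\Gamma$ (its elements appearing as consecutive elements at some bracket depth), and $\Delta(\Gamma')$ the result of replacing that occurrence by $\Gamma'$. A sequent is $\Pi \to A$ with $\Pi$ a meta-formula and $A$ a formula. Axioms: $A\to A$ and $\Lambda \to \mathbf{1}$. Rules (premises $\Rightarrow$ conclusion): $(/\to)$: $\Gamma\to B$ and $\Delta(C)\to D$ $\Rightarrow$ $\Delta(C/B,\Gamma)\to D$; $(\to/)$: $\Gamma,B\to C$ $\Rightarrow$ $\Gamma\to C/B$; $(\backslash\to)$: $\Gamma\to A$ and $\Delta(C)\to D$ $\Rightarrow$ $\Delta(\Gamma,A\backslash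 C)\to D$; $(\to\backslash)$: $A,\Gamma\to C$ $\Rightarrow$ $\Gamma\to A\backslash C$; $(\cdot\to)$: $\Delta(A,B)\to D$ $\Rightarrow$ $\Delta(A\cdot B)\to D$; $(\to\cdot)$: $\Gamma_1\to A$ and $\Gamma_2\to B$ $\Rightarrow$ $\Gamma_1,\Gamma_2\to A\cdot B$; $(\mathbf{1}\to)$: $\Delta(\Lambda)\to A$ $\Rightarrow$ $\Delta(\mathbf{1})\to A$; $(\langle\rangle\to)$: $\Delta([A])\to C$ $\Rightarrow$ $\Delta(\langle\rangle A)\to C$; $(\to\langle\rangle)$: $\Pi\to A$ $\Rightarrow$ $[\Pi]\to\langle\rangle A$; $([]^{-1}\to)$: $\Delta(A)\to C$ $\Rightarrow$ $\Delta([[]^{-1}A])\to C$; $(\to[]^{-1})$: $[\Pi]\to A$ $\Rightarrow$ $\Pi\to[]^{-1}A$; $(!\to)$: $\Gamma(A)\to B$ $\Rightarrow$ $\Gamma(!A)\to B$; $(\to!)$: $!A_1,\dots,!A_n\to A$ $\Rightarrow$ $!A_1,\dots,!A_n\to !A$; $(\mathrm{contr}_\mathbf{b})$: $\Delta(!A_1,\dots,!A_n,[!A_1,\dots,!A_n,\Gamma])\to B$ $\Rightarrow$ $\Delta(!A_1,\dots,!A_n,\Gamma)\to B$ ($n\ge 1$); $(\mathrm{perm}_1)$: $\Delta(!A,\Gamma)\to B$ $\Rightarrow$ $\Delta(\Gamma,!A)\to B$; $(\mathrm{perm}_2)$: $\Delta(\Gamma,!A)\to B$ $\Rightarrow$ $\Delta(!A,\Gamma)\to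 B$; $(\mathrm{cut})$: $\Pi\to A$ and $\Delta(A)\to C$ $\Rightarrow$ $\Delta(\Pi)\to C$. A sequent is derivable if it is obtained from axioms by these rules. *)

(* Defs.v *)
From mathcomp Require Import all_boot.

Set Implicit Arguments.
Unset Strict Implicit.
Unset Printing Implicit Defensive.

Inductive formula : Type :=
| Var of nat
| One
| Bsl of formula & formula  (* Bsl A C is A \ C *)
| Sl of formula & formula   (* Sl C B is C / B *)
| Prod of formula & formula
| Dia of formula
| BoxInv of formula
| Bang of formula.

Inductive item : Type :=
| Fm of formula
| Br of seq item.

Definition meta : Type := seq item.

(* The position of the designated occurrence in Delta(Gamma): [CHere l r] puts
   it between l and r, [CBr l c r] inside a bracket standing between l and r. *)
Inductive ctx : Type :=
| CHere of meta & meta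
| CBr of meta & ctx & meta.

Fixpoint fill (D : ctx) (G : meta) : meta :=
  match D with
  | CHere l r => l ++ G ++ r
  | CBr l D' r => l ++ Br (fill D' G) :: r
  end.

Definition bangs (As : seq formula) : meta := [seq Fm (Bang A) | A <- As].

Inductive derivable : meta -> formula -> Prop :=
| d_ax A : derivable [:: Fm A] A
| d_oneR : derivable [::] One
| d_slL G D B C E :
    derivable G B -> derivable (fill D [:: Fm C]) E ->
    derivable (fill D (Fm (Sl C B) :: G)) E
| d_slR G B C :
    derivable (G ++ [:: Fm B]) C -> derivable G (Sl C B)
| d_bslL G D A C E :
    derivable G A -> derivable (fill D [:: Fm C]) E ->
    derivable (fill D (G ++ [:: Fm (Bsl A C)])) E
| d_bslR G A C :
    derivable (Fm A :: G) C -> derivable G (Bsl A C)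
| d_prodL D A B E :
    derivable (fill D [:: Fm A; Fm B]) E ->
    derivable (fill D [:: Fm (Prod A B)]) E
| d_prodR G1 G2 A B :
    derivable G1 A -> derivable G2 B -> derivable (G1 ++ G2) (Prod A B)
| d_oneL D A :
    derivable (fill D [::]) A -> derivable (fill D [:: Fm One]) A
| d_diaL D A C :
    derivable (fill D [:: Br [:: Fm A]]) C ->
    derivable (fill D [:: Fm (Dia A)]) C
| d_diaR P A :
    derivable P A -> derivable [:: Br P] (Dia A)
| d_boxL D A C :
    derivable (fill D [:: Fm A]) C ->
    derivable (fill D [:: Br [:: Fm (BoxInv A)]]) C
| d_boxR P A :
    derivable [:: Br P] A -> derivable P (BoxInv A)
| d_bangL D A B :
    derivable (fill D [:: Fm A]) B -> derivable (fill D [:: Fm (Bang A)]) B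
| d_bangR As A :
    derivable (bangs As) A -> derivable (bangs As) (Bang A)
| d_contr D As G B :
    As <> [::] ->
    derivable (fill D (bangs As ++ [:: Br (bangs As ++ G)])) B ->
    derivable (fill D (bangs As ++ G)) B
| d_perm1 D A G B :
    derivable (fill D (Fm (Bang A) :: G)) B ->
    derivable (fill D (G ++ [:: Fm (Bang A)])) B
| d_perm2 D A G B :
    derivable (fill D (G ++ [:: Fm (Bang A)])) B ->
    derivable (fill D (Fm (Bang A) :: G)) B
| d_cut P D A C :
    derivable P A -> derivable (fill D [:: Fm A]) C ->
    derivable (fill D P) C.

Definition sequent : Type := (meta * formula)%type.

(* A sequent is written as a word over nat, formulae being in prefix (Polish)
   notation; the letters 0, ..., 6 are the connectives, 7 and 8 the opening and
   closing brackets, 9 the arrow, and 10 + i the i-th variable. *)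
Fixpoint formula_word (A : formula) : seq nat :=
  match A with
  | One => [:: 0]
  | Bsl B C => 1 :: formula_word B ++ formula_word C
  | Sl B C => 2 :: formula_word B ++ formula_word C
  | Prod B C => 3 :: formula_word B ++ formula_word C
  | Dia B => 4 :: formula_word B
  | BoxInv B => 5 :: formula_word B
  | Bang B => 6 :: formula_word B
  | Var i => [:: 10 + i]
  end.

Fixpoint item_word (x : item) : seq nat :=
  match x with
  | Fm A => formula_word A
  | Br P => 7 :: flatten [seq item_word y | y <- P] ++ [:: 8]
  end.

Definition sequent_word (S : sequent) : seq nat :=
  flatten [seq item_word x | x <- S.1] ++ 9 :: formula_word S.2.

Definition sequent_code (S : sequent) : nat := CodeSeq.code (sequent_word S).

Lemma formula_word_inj A B s t :
  formula_word A ++ s = formula_word B ++ t -> A = B /\ s = t.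
Proof.
elim: A B s t => [i||A1 IH1 A2 IH2|A1 IH1 A2 IH2|A1 IH1 A2 IH2|A1 IH1|A1 IH1
  |A1 IH1] [j||B1 B2|B1 B2|B1 B2|B1|B1|B1] s t //= [].
- by rewrite !add0n => -> ->.
- by move=> ->.
- by rewrite -!catA => /IH1[-> /IH2[-> ->]].
- by rewrite -!catA => /IH1[-> /IH2[-> ->]].
- by rewrite -!catA => /IH1[-> /IH2[-> ->]].
- by move=> /IH1[-> ->].
- by move=> /IH1[-> ->].
- by move=> /IH1[-> ->].
Qed.

Lemma formula_word_head A : exists a s,
  formula_word A = a :: s /\ a \notin [:: 7; 8; 9].
Proof. by case: A => *; do 2!eexists; split. Qed.

Lemma meta_word_inj (P Q : meta) (a b : nat) (s t : seq nat) :
  a \in [:: 8; 9] -> b \in [:: 8; 9] ->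
  flatten [seq item_word x | x <- P] ++ a :: s =
  flatten [seq item_word x | x <- Q] ++ b :: t ->
  [/\ P = Q, a = b & s = t].
Proof.
set mw := fun P : meta => flatten [seq item_word x | x <- P].
rewrite -/(mw P) -/(mw Q).
have [n] := ubnP (size (mw P)).
elim: n P Q a b s t => // n IHn [|x P] [|y Q] a b s t /=.
- by move=> _ _ _ [-> ->].
- rewrite /mw /= => _ Ha _; case: y => [B|R] /=.
    have [c [u [-> Hc]]] := formula_word_head B.
    by case=> Eac _; move: Hc Ha; rewrite -Eac !inE => /norP[_ /negPf->].
  by case=> E; move: Ha; rewrite E.
- rewrite /mw /= => _ _ Hb; case: x => [B|R] /=.
    have [c [u [-> Hc]]] := formula_word_head B.
    by case=> Ecb _; move: Hc Hb; rewrite Ecb !inE => /norP[_ /negPf->].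
  by case=> E; move: Hb; rewrite -E.
- rewrite /mw /= -/(mw P) -/(mw Q).
  case: x y => [A|R] [B|U] Hn Ha Hb /=.
  + have [c [u [Ec _]]] := formula_word_head A.
    rewrite -!catA => /formula_word_inj[-> E].
    suff [-> -> ->] : [/\ P = Q, a = b & s = t] by [].
    apply: IHn E => //; move: Hn; rewrite /= Ec size_cat /= addSn ltnS.
    by apply: leq_ltn_trans; rewrite leq_addl.
  + have [c [u [-> Hc]]] := formula_word_head A.
    by case=> Ec _; move: Hc; rewrite Ec.
  + have [c [u [-> Hc]]] := formula_word_head B.
    by case=> Ec _; move: Hc; rewrite -Ec.
  + case; rewrite -/(mw R) -/(mw U) -!catA /=.
    move: Hn; rewrite /= -/(mw R) !size_cat /= addn1 !addSn !ltnS => /ltnW Hn.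
    have HR : size (mw R) < n.
      by apply: leq_ltn_trans Hn; rewrite leq_addr.
    have HP : size (mw P) < n.
      by apply: leq_ltn_trans Hn; rewrite leq_addl.
    case/(IHn _ _ _ _ _ _ HR) => // -> _ E.
    by case: (IHn _ _ _ _ _ _ HP Ha Hb E) => -> -> ->.
Qed.

Lemma sequent_code_inj : injective sequent_code.
Proof.
move=> [P A] [Q B] /(can_inj CodeSeq.codeK).
rewrite /sequent_word /= => /meta_word_inj[] // -> _ E.
by have [|-> _] := @formula_word_inj A B [::] [::]; rewrite ?cats0.
Qed.

(* Minsky register machines, with registers and program lines numbered from 0:
   [Inc r j] increments register r and goes to line j; [Dec r j k] decrements
   register r and goes to line j if r is nonzero, and goes to line k otherwise.
   A machine halts when it reaches a line outside its program. *)
Inductive instr : Type :=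
| Inc of nat & nat
| Dec of nat & nat & nat.

Definition program : Type := seq instr.

Definition config : Type := (nat * (nat -> nat))%type.

Definition upd (v : nat -> nat) (r x : nat) : nat -> nat :=
  fun i => if i == r then x else v i.

Definition step (M : program) (c : config) : config :=
  let: (q, v) := c in
  match onth M q with
  | Some (Inc r j) => (j, upd v r (v r).+1)
  | Some (Dec r j k) => if v r is x.+1 then (j, upd v r x) else (k, v)
  | None => c
  end.

(* Started at line 0 with n in register 0 and 0 in all the other registers,
   M halts with y in register 0. *)
Definition computes (M : program) (n y : nat) : Prop :=
  exists t : nat,
    let: (q, v) := iter t (step M) (0, upd (fun=> 0) 0 n) in
    size M <= q /\ v 0 = y.

Definition decides (T : Type) (code : T -> nat) (M : program) (P : T -> Prop) :
    Prop :=
  forall x : T, exists b : bool, computes M (code x) b /\ (P x <-> b).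

Definition algorithmically_decidable (T : Type) (code : T -> nat)
    (P : T -> Prop) : Prop :=
  exists M : program, decides code M P.

(* Main.v *)
Require Import Defs.
From mathcomp Require Import all_boot zify.

(** A rewriting rule u -> v is the formula ![]^-1(v / u): contracting with an
    empty Gamma leaves a copy [[]^-1(v / u)] whose bracket is removed at once,
    so a copy of v / u can be produced wherever it is needed; no weakening is
    required because the goal also asks for all the !-formulae. Conversely, the
    calculus, cut included, is sound in the closed sets of words for the closure
    operator given by the set of words that reduce to the final letter, with
    brackets read as the identity and !A as the closure of A restricted to the
    empty word; there every rule u -> v holds, so derivability yields a reduction.

    A counter machine is a rewriting system on the words
    #0 a^v0 #1 a^v1 ... #k through which a state letter moves freely.

    A decider M is refuted by self-reference. For a counter machine N the sequent
    "N accepts x" has the code G (F^x c), with F and G fixed and c depending only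
    on N. Let N compute G (F^x x) from x, run M on the result and accept when M
    answers no; then N on input c asks M about the sequent "N accepts c". *)

Set Implicit Arguments.
Unset Strict Implicit.
Unset Printing Implicit Defensive.

(** * String rewriting inside the calculus *)

Definition rules : Type := seq (seq nat * seq nat).

Inductive reduces (R : rules) (f : nat) : seq nat -> Prop :=
| red_refl : reduces R f [:: f]
| red_step l u v r :
    (u, v) \in R -> reduces R f (l ++ v ++ r) -> reduces R f (l ++ u ++ r).

Definition wprod (w : seq nat) : formula :=
  foldr (fun i A => Prod (Var i) A) One w.

Definition rule_formula (r : seq nat * seq nat) : formula :=
  BoxInv (Sl (wprod r.2) (wprod r.1)).

Definition bang_prod (As : seq formula) : formula :=
  foldr (fun A B => Prod (Bang A) B) One As.

Definition wmeta (w : seq nat) : meta := [seq Fm (Var i) | i <- w].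

Definition goal (R : rules) (f : nat) : formula :=
  Prod (Var f) (bang_prod (map rule_formula R)).

Definition rules_sequent (R : rules) (f : nat) (w : seq nat) : sequent :=
  (wmeta w ++ bangs (map rule_formula R), goal R f).

Lemma derivable_wprod w : derivable (wmeta w) (wprod w).
Proof.
elim: w => [|i w IH]; first exact: d_oneR.
exact: (d_prodR (d_ax (Var i)) IH).
Qed.

Lemma derivable_bang_prod As : derivable (bangs As) (bang_prod As).
Proof.
elim: As => [|A As IH]; first exact: d_oneR.
exact: (d_prodR (d_ax (Bang A)) IH).
Qed.

Lemma derivable_wprodL l w r E :
  derivable (l ++ wmeta w ++ r) E -> derivable (l ++ Fm (wprod w) :: r) E.
Proof.
elim: w l => [|i w IH] l H; first exact: (@d_oneL (CHere l r)).
apply: (@d_prodL (CHere l r)) => /=.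
by rewrite -cat_rcons; apply: IH; rewrite cat_rcons.
Qed.

Lemma derivable_bang_left l m A r E :
  derivable (l ++ Fm (Bang A) :: m ++ r) E ->
  derivable (l ++ m ++ Fm (Bang A) :: r) E.
Proof.
move=> H; rewrite -[Fm _ :: r]/([:: Fm (Bang A)] ++ r) (catA m).
exact: (@d_perm1 (CHere l r)).
Qed.

Lemma derivable_bang_right l m A r E :
  derivable (l ++ m ++ Fm (Bang A) :: r) E ->
  derivable (l ++ Fm (Bang A) :: m ++ r) E.
Proof.
by move=> H; apply: (@d_perm2 (CHere l r) A m) => /=; rewrite -catA.
Qed.

Lemma derivable_rule R u v l r E :
  (u, v) \in R ->
  derivable (wmeta (l ++ v ++ r) ++ bangs (map rule_formula R)) E ->
  derivable (wmeta (l ++ u ++ r) ++ bangs (map rule_formula R)) E.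
Proof.
case/path.splitPr=> R1 R2.
rewrite /wmeta /bangs !map_cat map_cons -/(bangs _) -/(bangs (map _ R2)).
rewrite -/(wmeta l) -/(wmeta u) -/(wmeta v) -/(wmeta r).
set b1 := bangs _; set b2 := bangs _.
set A := rule_formula (u, v) => H.
have e w : (wmeta l ++ wmeta w ++ wmeta r) ++ b1 ++ Fm (Bang A) :: b2 =
    wmeta l ++ (wmeta w ++ wmeta r ++ b1) ++ Fm (Bang A) :: b2.
  by rewrite -!catA.
rewrite e; apply: derivable_bang_left; move: H.
rewrite e => /derivable_bang_right H.
set t := (X in _ :: X).
(* Contraction with an empty Gamma yields [[!A]] to the right of [!A]; dereliction and the left rule
   for [BoxInv] turn this bracket into [v / u], standing just before [u]. *)
apply: (@d_contr (CHere (wmeta l) t) [:: A] [::]) => //=.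
rewrite -[[:: _, _ & t]]/([:: Fm (Bang A)] ++ _) catA.
apply: (@d_bangL (CBr _ (CHere [::] [::]) t)) => /=.
apply: (@d_boxL (CHere _ t)) => /=.
have -> : t = wmeta u ++ wmeta r ++ b1 ++ b2 by rewrite /t -!catA.
apply: (@d_slL (wmeta u) (CHere (wmeta l ++ [:: Fm (Bang A)]) _)).
  exact: derivable_wprod.
by apply: derivable_wprodL; rewrite -!catA in H *; exact: H.
Qed.

Lemma reduces_derivable R f w :
  reduces R f w ->
  derivable (rules_sequent R f w).1 (rules_sequent R f w).2.
Proof.
elim=> [|l u v r uv _ IH]; last exact: derivable_rule uv IH.
exact: (d_prodR (d_ax (Var f)) (derivable_bang_prod _)).
Qed.

(** * A language model in which brackets are invisible *)

Section Model.

Variable pole : seq nat -> Prop.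

(** The biorthogonal closure for [pole]: a pair [(l, r)] is a test, passed by [x] when [l ++ x ++ r]
    lies in [pole]. *)
Definition clo (X : seq nat -> Prop) (w : seq nat) : Prop :=
  forall l r, (forall x, X x -> pole (l ++ x ++ r)) -> pole (l ++ w ++ r).

Fixpoint sem (A : formula) : seq nat -> Prop :=
  match A with
  | Var i => clo (eq [:: i])
  | One => clo (eq [::])
  | Bsl A C => fun w => forall a, sem A a -> sem C (a ++ w)
  | Sl C B => fun w => forall b, sem B b -> sem C (w ++ b)
  | Prod A B => clo (fun w => exists a b, [/\ w = a ++ b, sem A a & sem B b])
  | Dia A => sem A
  | BoxInv A => sem A
  | Bang A => clo (fun w => w = [::] /\ sem A [::])
  end.

Fixpoint sems (s : seq formula) (w : seq nat) : Prop :=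
  match s with
  | [::] => w = [::]
  | A :: s' => exists a b, [/\ w = a ++ b, sem A a & sems s' b]
  end.

Fixpoint item_formulas (x : item) : seq formula :=
  match x with
  | Fm A => [:: A]
  | Br P => flatten [seq item_formulas y | y <- P]
  end.

Definition formulas (P : meta) : seq formula :=
  flatten [seq item_formulas x | x <- P].

Lemma formulas_cat P Q : formulas (P ++ Q) = formulas P ++ formulas Q.
Proof. by rewrite /formulas map_cat flatten_cat. Qed.

Lemma formulas_bangs As : formulas (bangs As) = map Bang As.
Proof. by elim: As => //= A As; rewrite /formulas /= => ->. Qed.

(** Brackets are invisible, so a context of any depth merely concatenates fixed sequences on both
    sides. *)
Lemma formulas_fill D :
  exists L R, forall G, formulas (fill D G) = L ++ formulas G ++ R.
Proof.
elim: D => [l r|l D [L [R IH]] r] /=.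
  by exists (formulas l), (formulas r) => G; rewrite !formulas_cat.
exists (formulas l ++ L), (R ++ formulas r) => G.
rewrite formulas_cat -[formulas (_ :: r)]/(formulas (fill D G) ++ formulas r).
by rewrite IH -!catA.
Qed.

Lemma clo_sub (X : seq nat -> Prop) w : X w -> clo X w.
Proof. by move=> Xw l r; apply. Qed.

Lemma clo_mono (X Y : seq nat -> Prop) w :
  (forall x, X x -> clo Y x) -> clo X w -> clo Y w.
Proof. by move=> XY Xw l r H; apply: Xw => x /XY; apply. Qed.

Lemma clo_cat (X Y Z : seq nat -> Prop) a b :
  (forall x y, X x -> Y y -> clo Z (x ++ y)) ->
  clo X a -> clo Y b -> clo Z (a ++ b).
Proof.
move=> XYZ Xa Yb l r H; rewrite -catA; apply: Xa => x Xx.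
rewrite catA; apply: Yb => y Yy.
by rewrite -catA (catA x); apply: XYZ.
Qed.

(** In the two implications the argument is absorbed into the test, [a] on the left and [b] on the
    right. *)
Lemma sem_closed A w : clo (sem A) w -> sem A w.
Proof.
elim: A w => [i||A IHA C IHC|C IHC B IHB|A _ B _|A IH|A IH|A _] w //=;
  try by [exact: IH | move=> H; apply: (clo_mono _ H)].
- move=> H a Aa; apply: IHC => l r Hc; rewrite -catA catA; apply: H => x Hx.
  by rewrite -catA (catA a); apply: Hc; apply: Hx.
- move=> H b Bb; apply: IHC => l r Hc; rewrite -catA; apply: H => x Hx.
  by rewrite (catA x); apply: Hc; apply: Hx.
Qed.

Lemma sems_cat s t w :
  sems (s ++ t) w <-> exists a b, [/\ w = a ++ b, sems s a & sems t b].
Proof.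
elim: s w => [|A s IH] w /=; split.
- by exists [::], w.
- by case=> a [b [-> -> ]].
- case=> a [b [-> Aa /IH[c [d [-> sc td]]]]].
  by exists (a ++ c), d; rewrite catA; split=> //; exists a, c.
- case=> a [b [-> [c [d [-> Ac sd]]] tb]].
  by exists c, (d ++ b); rewrite catA; split=> //; apply/IH; exists d, b.
Qed.

Lemma sems1 A w : sems [:: A] w <-> sem A w.
Proof.
split=> [/=[a [b [-> Aa ->]]]|Aw]; first by rewrite cats0.
by exists w, [::]; rewrite cats0.
Qed.

(** A left rule changes only the designated occurrence, so a local inclusion suffices; it may land
    in the closure because [sem E] is closed. *)
Lemma sems_replace X Y E D :
  (forall w, sems (formulas X) w -> clo (sems (formulas Y)) w) ->
  (forall w, sems (formulas (fill D Y)) w -> sem E w) ->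
  forall w, sems (formulas (fill D X)) w -> sem E w.
Proof.
move=> XY; have [L [R e]] := formulas_fill D; rewrite !e => H w.
case/sems_cat=> a [b [-> La /sems_cat[x [c [-> /XY Yx Rc]]]]].
apply: sem_closed => l r Hp; rewrite -!catA catA.
apply: Yx => y Yy.
have -> : (l ++ a) ++ y ++ c ++ r = l ++ (a ++ y ++ c) ++ r by rewrite -!catA.
apply: Hp; apply: H; apply/sems_cat; exists a, (y ++ c); split=> //.
by apply/sems_cat; exists y, c.
Qed.

(** Each [!]-formula behaves as the empty word, which makes contraction, permutation and the right
    rule for [!] sound. *)
Lemma sems_bangs As w :
  sems (map Bang As) w -> clo (fun x => x = [::] /\ sems (map Bang As) [::]) w.
Proof.
elim: As w => [|A As IH] w /=; first by move=> ->; apply: clo_sub.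
case=> a [b [-> Aa /IH]]; apply: clo_cat Aa => x y [-> Ax] [-> Asx].
apply: clo_sub; split=> //; exists [::], [::]; split=> //.
exact: clo_sub.
Qed.

Lemma derivable_sem P A :
  derivable P A -> forall w, sems (formulas P) w -> sem A w.
Proof.
elim=> {P A}.
- by move=> A w /sems1.
- by move=> w /= ->; apply: clo_sub.
- move=> G D B C E _ IHG _; apply: sems_replace => w [a [b [-> Ca Gb]]].
  by apply/clo_sub/sems1/Ca/IHG.
- move=> G B C _ IH w Gw b Bb; apply: IH; rewrite formulas_cat.
  by apply/sems_cat; exists w, b; split=> //; apply/sems1.
- move=> G D A C E _ IHG _; apply: sems_replace => w.
  rewrite formulas_cat => /sems_cat[a [b [-> Ga /sems1 Cb]]].
  by apply/clo_sub/sems1/Cb/IHG.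
- by move=> G A C _ IH w Gw b Bb; apply: IH; exists b, w.
- move=> D A B E _; apply: sems_replace => w /sems1; apply: clo_mono => x.
  by case=> a [b [-> Aa Bb]]; apply: clo_sub; exists a, b; split=> //; apply/sems1.
- move=> G1 G2 A B _ IH1 _ IH2 w; rewrite formulas_cat.
  case/sems_cat=> a [b [-> Ga Gb]]; apply: clo_sub.
  by exists a, b; split; [|apply: IH1|apply: IH2].
- by move=> D A _; apply: sems_replace => w /sems1; apply: clo_mono => x <-; apply: clo_sub.
- by move=> D A C _; apply: sems_replace => w; apply: clo_sub.
- by move=> P A _ IH w; rewrite /formulas /= cats0; apply: IH.
- by move=> D A C _; apply: sems_replace => w; apply: clo_sub.
- by move=> P A _ IH w Pw; apply: IH; rewrite /formulas /= cats0.
- move=> D A B _; apply: sems_replace => w /sems1; apply: clo_mono => x [-> Ax].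
  exact/clo_sub/sems1.
- move=> As A _ IH w; rewrite formulas_bangs => /sems_bangs.
  apply: clo_mono => x [-> H]; apply: clo_sub; split=> //.
  by apply: IH; rewrite formulas_bangs.
(* The empty word may be used twice, for the [!]-formulae outside and inside the bracket. *)
- move=> D As G B _ _; apply: sems_replace => w.
  rewrite formulas_cat formulas_bangs => /sems_cat[a [b [-> /sems_bangs Aa Gb]]].
  apply: clo_cat Aa (clo_sub (erefl b)) => x y [-> H] <-; apply: clo_sub.
  rewrite formulas_cat -[formulas [:: _]]/(formulas _ ++ [::]) cats0.
  rewrite formulas_cat formulas_bangs; apply/sems_cat; exists [::], b; split=> //.
  by apply/sems_cat; exists [::], b.
- move=> D A G B _; apply: sems_replace => w.
  rewrite formulas_cat => /sems_cat[a [b [-> Ga /sems1 Ab]]].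
  apply: clo_cat (clo_sub (erefl a)) Ab => x y <- [-> A0]; rewrite cats0.
  by apply: clo_sub; exists [::], a; split=> //; apply: clo_sub.
- move=> D A G B _; apply: sems_replace => w [a [b [-> Aa Gb]]].
  apply: clo_cat Aa (clo_sub (erefl b)) => x y [-> A0] <-.
  apply: clo_sub; rewrite formulas_cat; apply/sems_cat; exists b, [::].
  by rewrite cats0; split=> //; apply/sems1/clo_sub.
- move=> P D A C _ IH _; apply: sems_replace => w /IH Aw.
  exact/clo_sub/sems1.
Qed.

(** * Interpretation of the rule sequents *)

Lemma sem_wprod w x : sem (wprod w) x <-> clo (eq w) x.
Proof.
elim: w x => [|i w IH] x //=; split; apply: clo_mono => y.
  case=> a [b [-> Xa /IH Xb]]; apply: clo_cat Xa Xb => ? ? <- <-.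
  exact: clo_sub.
move=> <-; apply: clo_sub; exists [:: i], w; split=> //.
  exact: clo_sub.
exact/IH/clo_sub.
Qed.

Lemma sem_bang_prod As x : sem (bang_prod As) x -> clo (eq [::]) x.
Proof.
elim: As x => [|A As IH] x //=; apply: clo_mono => y [a [b [-> Xa /IH]]].
by apply: clo_cat Xa => ? ? [-> _] <-; apply: clo_sub.
Qed.

Lemma sems_wmeta w : sems (formulas (wmeta w)) w.
Proof.
by elim: w => //= i w IH; exists [:: i], w; split=> //; apply: clo_sub.
Qed.

(** Each rule formula contains the empty word, so the antecedent contains [w]; the goal lies in the
    closure of [[:: f]], and the empty test then puts [w] in [pole]. *)
Lemma derivable_pole (R : rules) (f : nat) w :
  (forall u v l r, (u, v) \in R -> pole (l ++ v ++ r) -> pole (l ++ u ++ r)) ->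
  pole [:: f] ->
  derivable (rules_sequent R f w).1 (rules_sequent R f w).2 -> pole w.
Proof.
move=> HR Hf /derivable_sem /(_ w) /= H.
suff /H /(_ [::] [::]) : sems (formulas (wmeta w ++ bangs (map rule_formula R))) w.
  rewrite /= cats0; apply=> x [a [b [-> fa /sem_bang_prod b1]]].
  have : clo (eq [:: f]) (a ++ b).
    by apply: clo_cat fa b1 => ? ? <- <-; apply: clo_sub.
  by move/(_ [::] [::]); rewrite /= !cats0; apply=> ? <-.
rewrite formulas_cat formulas_bangs; apply/sems_cat; exists w, [::].
rewrite cats0; split=> //; first exact: sems_wmeta.
elim: R HR {H} => //= -[u v] R IH HR; exists [::], [::]; split=> //.
  (* At the empty word, [v / u] says that every test passed by [v] is passed by [u], which is the
     hypothesis on [pole]. *)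
  apply: clo_sub; split=> //= b /sem_wprod Hb; apply/sem_wprod.
  apply: clo_mono Hb => x <- l r Hp; apply: (HR u v); last exact: Hp.
  by rewrite mem_head.
by apply: IH => ? ? ? ? H; apply: HR; rewrite inE H orbT.
Qed.

End Model.

Lemma derivable_reduces R f w :
  derivable (rules_sequent R f w).1 (rules_sequent R f w).2 <-> reduces R f w.
Proof.
split; last exact: reduces_derivable.
by apply: derivable_pole => *; [apply: red_step; eassumption | apply: red_refl].
Qed.

(** * Counter machines as string rewriting *)

Inductive ginstr : Type :=
| Add of nat & nat & nat
| Sub of nat & nat & nat.

Definition reg (i : ginstr) : nat :=
  match i with Add r _ _ => r | Sub r _ _ => r end.

(** The registers are arbitrary at the end, and only line [size P] accepts: a jump beyond it
    rejects. *)
Inductive accepts (P : seq ginstr) : nat -> (nat -> nat) -> Prop :=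
| acc_end v : accepts P (size P) v
| acc_add q v r m j :
    onth P q = Some (Add r m j) -> accepts P j (upd v r (v r + m)) ->
    accepts P q v
| acc_sub q v r j k x :
    onth P q = Some (Sub r j k) -> v r = x.+1 -> accepts P j (upd v r x) ->
    accepts P q v
| acc_zero q v r j k :
    onth P q = Some (Sub r j k) -> v r = 0 -> accepts P k v ->
    accepts P q v.

(** Parity separates the kinds of letters: zero for units, odd for separators, positive even for
    states. *)
Definition unit_letter : nat := 0.
Definition sep (i : nat) : nat := i.*2.+1.
Definition state (q : nat) : nat := q.*2.+2.

Definition is_state (x : nat) : bool := (0 < x) && ~~ odd x.

Lemma is_state_state q : is_state (state q).
Proof. by rewrite /is_state /= odd_double. Qed.

Lemma is_state_sep i : is_state (sep i) = false.
Proof. by rewrite /is_state /= odd_double. Qed.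

Lemma sep_inj : injective sep.
Proof. by move=> i j [] /double_inj. Qed.

Lemma state_inj : injective state.
Proof. by move=> i j [] /double_inj. Qed.

Section Simulation.

Variables (P : seq ginstr) (k : nat).

(** The [k] registers take [k.+1] separators: [sep k] closes the last block, so an empty block is
    always followed by a separator. *)
Definition alphabet : seq nat := unit_letter :: map sep (iota 0 k.+1).

(** The state acts only just after [sep r]; for [Sub] the next letter, a unit or [sep r.+1], tells
    whether the register is zero. *)
Definition instr_rules (q : nat) (i : ginstr) : rules :=
  match i with
  | Add r m j =>
      [:: ([:: sep r; state q], sep r :: state j :: nseq m unit_letter)]
  | Sub r j k =>
      [:: ([:: sep r; state q; unit_letter], [:: sep r; state j]);
          ([:: sep r; state q; sep r.+1], [:: sep r; state k; sep r.+1])]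
  end.

Definition move_rules (q : nat) : rules :=
  [seq ([:: state q; x], [:: x; state q]) | x <- alphabet] ++
  [seq ([:: x; state q], [:: state q; x]) | x <- alphabet].

(** Meant for the accepting state, which swallows its surroundings until it stands alone. *)
Definition erase_rules (q : nat) : rules :=
  [seq ([:: state q; x], [:: state q]) | x <- alphabet] ++
  [seq ([:: x; state q], [:: state q]) | x <- alphabet].

Definition line_rules (q : nat) : rules :=
  move_rules q ++ (if onth P q is Some i then instr_rules q i else [::]).

Definition machine_rules : rules :=
  erase_rules (size P) ++ flatten (map line_rules (iota 0 (size P))).

Definition block (v : nat -> nat) (i : nat) : seq nat :=
  sep i :: nseq (v i) unit_letter.

Definition before (v : nat -> nat) (i : nat) : seq nat :=
  flatten (map (block v) (iota 0 i)).

Definition after (v : nat -> nat) (i : nat) : seq nat :=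
  flatten (map (block v) (iota i.+1 (k - i.+1))) ++ [:: sep k].

Definition canon (v : nat -> nat) : seq nat := before v k ++ [:: sep k].

Notation red := (reduces machine_rules (state (size P))).

(** * Unique decomposition of canonical words *)

Lemma canonE v i : i < k ->
  canon v = before v i ++ sep i :: nseq (v i) unit_letter ++ after v i.
Proof.
move=> ik; rewrite /canon /before /after.
have -> : k = i + (1 + (k - i.+1)) by lia.
rewrite !iotaD !map_cat !flatten_cat /= cats0 -!catA /= -catA add0n addn1.
by have -> : i + (1 + (k - i.+1)) - i.+1 = k - i.+1 by lia.
Qed.

Lemma mem_blocks v s x :
  x \in flatten (map (block v) s) ->
  x = unit_letter \/ exists2 i, i \in s & x = sep i.
Proof.
case/flattenP=> _ /mapP[i si ->]; rewrite inE => /orP[/eqP->|].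
  by right; exists i.
by rewrite mem_nseq => /andP[_ /eqP->]; left.
Qed.

Lemma canon_alphabet v : {subset canon v <= alphabet}.
Proof.
move=> x; rewrite mem_cat inE => /orP[/mem_blocks[->|[i si ->]]|/eqP->].
- exact: mem_head.
- by rewrite inE map_f ?orbT // mem_iota; rewrite mem_iota in si; lia.
- by rewrite inE map_f ?orbT // mem_iota; lia.
Qed.

Lemma alphabet_state x : x \in alphabet -> is_state x = false.
Proof. by rewrite inE => /orP[/eqP->|/mapP[i _ ->]] //; apply: is_state_sep. Qed.

Lemma sep_before v i : sep i \notin before v i.
Proof.
apply/negP=> /mem_blocks[//|[j]]; rewrite mem_iota => H /sep_inj E; lia.
Qed.

Lemma sep_after v i : i < k -> sep i \notin nseq (v i) unit_letter ++ after v i.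
Proof.
move=> ik; rewrite !mem_cat mem_nseq inE !negb_or andbF /=; apply/andP; split.
  by apply/negP=> /mem_blocks[//|[j]]; rewrite mem_iota => H /sep_inj E; lia.
by apply/eqP=> /sep_inj E; lia.
Qed.

Lemma before_upd v i x : before (upd v i x) i = before v i.
Proof.
rewrite /before; congr flatten; apply/eq_in_map => j; rewrite mem_iota => H.
by rewrite /block /upd; case: eqP => // ?; lia.
Qed.

Lemma after_upd v i x : after (upd v i x) i = after v i.
Proof.
rewrite /after; congr (flatten _ ++ _); apply/eq_in_map => j.
by rewrite mem_iota => H; rewrite /block /upd; case: eqP => // ?; lia.
Qed.

Lemma after_head v i : i < k -> exists t, after v i = sep i.+1 :: t.
Proof.
rewrite /after leq_eqVlt => /orP[/eqP<-|ik].
  by rewrite subnn; exists [::].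
have -> : k - i.+1 = (k - i.+2).+1 by lia.
by eexists.
Qed.

(** Outside the position of [s0] no letter satisfies [p], so [s] must be that one. *)
Lemma cat_split_uniq (p : pred nat) l s r l0 s0 r0 :
  ~~ has p l0 -> ~~ has p r0 -> p s ->
  l ++ s :: r = l0 ++ s0 :: r0 -> [/\ l = l0, s = s0 & r = r0].
Proof.
move=> + pr ps; elim: l l0 => [|x l IH] [|y l0] //=.
- by move=> _ [-> ->].
- by move=> + [E _]; rewrite -E ps.
- by move=> _ [_ E]; case/negP: pr; rewrite -E has_cat /= ps orbT.
- by rewrite negb_or => /andP[_ /IH{}IH] [-> /IH[-> -> ->]].
Qed.

Lemma canon_split v l i r : i < k -> l ++ sep i :: r = canon v ->
  l = before v i /\ r = nseq (v i) unit_letter ++ after v i.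
Proof.
move=> ik; rewrite (canonE v ik).
case/(@cat_split_uniq (pred1 (sep i))); rewrite ?has_pred1 //=.
- exact: sep_before.
- exact: sep_after.
Qed.

Lemma canon_nstate v l r : l ++ r = canon v ->
  ~~ has is_state l /\ ~~ has is_state r.
Proof.
move=> E; apply/andP; rewrite -negb_or -has_cat E; apply/hasPn => x /canon_alphabet.
by move/alphabet_state->.
Qed.

Lemma state_split v q0 l0 r0 l q r : l0 ++ r0 = canon v ->
  l ++ state q :: r = l0 ++ state q0 :: r0 -> [/\ l = l0, q = q0 & r = r0].
Proof.
move=> /canon_nstate[nl nr] /(cat_split_uniq nl nr (is_state_state q)).
by case=> -> /state_inj -> ->.
Qed.

Lemma canon_cat_upd v i x l r : i < k -> l = before v i -> r = after v i ->
  l ++ sep i :: nseq x unit_letter ++ r = canon (upd v i x).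
Proof.
move=> ik -> ->; rewrite (canonE _ ik) before_upd after_upd.
by rewrite /upd eqxx.
Qed.

(** * Equivalence of acceptance and reduction *)

Hypothesis regs_lt : all (fun i => reg i < k) P.

Lemma reg_lt q i : onth P q = Some i -> reg i < k.
Proof.
move=> E; have qP : q < size P by rewrite -onthTE E.
by have /(all_nthP i)/(_ q qP) := regs_lt; rewrite (onth_nth i _ _ _ E).
Qed.

Lemma red_line q l u v r : q < size P -> (u, v) \in line_rules q ->
  red (l ++ v ++ r) -> red (l ++ u ++ r).
Proof.
move=> qP uv; apply: red_step; rewrite mem_cat; apply/orP; right.
by apply/flattenP; exists (line_rules q) => //; apply: map_f; rewrite mem_iota.
Qed.

Lemma red_instr q i l u v r : onth P q = Some i -> (u, v) \in instr_rules q i ->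
  red (l ++ v ++ r) -> red (l ++ u ++ r).
Proof.
move=> E uv; apply: (@red_line q); first by rewrite -onthTE E.
by rewrite mem_cat E uv orbT.
Qed.

Lemma red_swap q x l r : q < size P -> x \in alphabet ->
  red (l ++ x :: state q :: r) <-> red (l ++ state q :: x :: r).
Proof.
move=> qP xA; split.
  apply: (@red_line q _ [:: state q; x] [:: x; state q]) => //.
  by rewrite !mem_cat; apply/orP; left; apply/orP; left; apply/mapP; exists x.
apply: (@red_line q _ [:: x; state q] [:: state q; x]) => //.
by rewrite !mem_cat; apply/orP; left; apply/orP; right; apply/mapP; exists x.
Qed.

Lemma red_to_front q l r : q < size P -> {subset l <= alphabet} ->
  red (l ++ state q :: r) <-> red (state q :: l ++ r).
Proof.
move=> qP; elim/last_ind: l r => [|l x IH] r sl //.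
have xA : x \in alphabet by apply: sl; rewrite mem_rcons mem_head.
rewrite !cat_rcons red_swap // IH // => y yl; apply: sl.
by rewrite mem_rcons inE yl orbT.
Qed.

(** Moves go both ways, so both words are equivalent to the one with the state in front. *)
Lemma red_slide q l r l' r' v : q < size P ->
  l ++ r = canon v -> l' ++ r' = canon v ->
  red (l' ++ state q :: r') -> red (l ++ state q :: r).
Proof.
move=> qP E E'; have sub s t : s ++ t = canon v -> {subset s <= alphabet}.
  by move=> e x xs; apply: (@canon_alphabet v); rewrite -e mem_cat xs.
by rewrite !red_to_front ?E ?E' //; apply: sub; eassumption.
Qed.

Lemma red_end l r : {subset l ++ r <= alphabet} -> red (l ++ state (size P) :: r).
Proof.
elim/last_ind: l => [|l x IH] /=.
  elim: r => [|x r IH] sr; first exact: red_refl.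
  apply: (@red_step _ _ [::] [:: _; x] [:: state (size P)]); last first.
    by apply: IH => y yr; apply: sr; rewrite inE yr orbT.
  rewrite !mem_cat; apply/orP; left; apply/orP; left; apply/mapP; exists x => //.
  by apply: sr; rewrite mem_head.
rewrite !cat_rcons => sr.
apply: (@red_step _ _ l [:: x; _] [:: state (size P)]); last first.
  apply: IH => y yr; apply: sr; move: yr; rewrite !mem_cat inE.
  by case/orP=> ->; rewrite ?orbT.
rewrite !mem_cat; apply/orP; left; apply/orP; right; apply/mapP; exists x => //.
by apply: sr; rewrite mem_cat mem_head orbT.
Qed.

Lemma accepts_red q v l r :
  accepts P q v -> l ++ r = canon v -> red (l ++ state q :: r).
Proof.
move=> H; elim: H l r => {q v}.
- move=> v l r E; apply: red_end; rewrite E; exact: canon_alphabet.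
- move=> q v i m j E _ IH l r e; have ik : i < k := reg_lt E.
  have qP : q < size P by rewrite -onthTE E.
  (* The state first travels to the place just after [sep i], where its instruction applies. *)
  apply: (red_slide (l' := before v i ++ [:: sep i])
    (r' := nseq (v i) unit_letter ++ after v i) qP e).
    by rewrite -catA -canonE.
  rewrite -catA; apply: (red_instr (u := [:: _; _]) E (mem_head _ _)) => /=.
  rewrite -cat_rcons; apply: IH; rewrite cat_rcons catA.
  by rewrite -nseqD addnC (@canon_cat_upd v).
- move=> q v i j z x E vi _ IH l r e; have ik : i < k := reg_lt E.
  have qP : q < size P by rewrite -onthTE E.
  apply: (red_slide (l' := before v i ++ [:: sep i])
    (r' := nseq (v i) unit_letter ++ after v i) qP e).
    by rewrite -catA -canonE.
  rewrite vi -catA; apply: (red_instr (u := [:: _; _; _]) E (mem_head _ _)) => /=.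
  rewrite -cat_rcons; apply: IH; rewrite cat_rcons.
  by rewrite (@canon_cat_upd v).
- move=> q v i j z E vi _ IH l r e; have ik : i < k := reg_lt E.
  have qP : q < size P by rewrite -onthTE E.
  apply: (red_slide (l' := before v i ++ [:: sep i])
    (r' := nseq (v i) unit_letter ++ after v i) qP e).
    by rewrite -catA -canonE.
  have [t et] := after_head v ik.
  rewrite vi -catA /= et.
  apply: (@red_instr _ _ _ [:: _; _; _] [:: sep i; state z; sep i.+1] _ E).
    by rewrite !inE eqxx orbT.
  rewrite /= -cat_rcons; apply: IH.
  by rewrite cat_rcons (canonE v ik) vi et.
Qed.

(** The state letter occurs once and every rule involves it: a move keeps the configuration, an
    instruction rule carries out that instruction, and an erasing rule shows that the state is
    already accepting. *)
Lemma red_accepts w q v l r :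
  red w -> w = l ++ state q :: r -> l ++ r = canon v -> accepts P q v.
Proof.
move=> H; elim: H q v l r => {w} [|l0 u u' r0 + _ IH] q v l r.
  by move=> E e; case: (state_split (l := [::]) e E) => _ <- _; apply: acc_end.
have end_case a b : l0 ++ u ++ r0 = a ++ state (size P) :: b ->
    l0 ++ u ++ r0 = l ++ state q :: r -> l ++ r = canon v -> accepts P q v.
  by move=> -> E e; case: (state_split e E) => _ <- _; apply: acc_end.
rewrite !mem_cat => /orP[/orP[]/mapP[x _ [eu _]]|].
- by apply: (end_case l0 (x :: r0)); rewrite eu.
- by apply: (end_case (rcons l0 x) r0); rewrite eu cat_rcons.
case/flattenP=> _ /mapP[q' _ ->]; rewrite !mem_cat.
case/orP=> [/orP[]/mapP[x _ [eu eu']]|].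
- rewrite eu => E e; case: (state_split e E) => el eq er.
  apply: (IH q v (rcons l0 x) r0); rewrite ?eu' ?eq cat_rcons //.
  by rewrite -e -el -er.
- rewrite eu -[_ ++ r0]/([:: x] ++ state q' :: r0) catA => E e.
  case: (state_split e E) => el eq er.
  by apply: (IH q v l0 (x :: r0)); rewrite ?eu' ?eq // -e -el -er -catA.
case Ei: (onth P q') => [[i m j|i j z]|] //=; have ik : i < k := reg_lt Ei.
- rewrite inE => /eqP[eu eu'].
  rewrite eu -[_ ++ r0]/([:: sep i] ++ state q' :: r0) catA => E e.
  case: (state_split e E) => el eq er; rewrite -eq.
  move: e; rewrite -el -er -catA => /(canon_split ik)[e1 e2].
  apply: acc_add Ei _; apply: (IH j _ (rcons l0 (sep i)) (nseq m unit_letter ++ r0)).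
    by rewrite eu' cat_rcons.
  by rewrite cat_rcons e2 catA -nseqD addnC (@canon_cat_upd v).
- rewrite !inE => /orP[]/eqP[eu eu'].
    rewrite eu -[_ ++ r0]/([:: sep i] ++ state q' :: unit_letter :: r0) catA => E e.
    case: (state_split e E) => el eq er; rewrite -eq.
    move: e; rewrite -el -er -catA => /(canon_split ik)[e1].
    (* A unit right after [sep i] excludes zero, since an empty block is followed by a separator. *)
    case Ev: (v i) => [|x] /=.
      by have [t ->] := after_head v ik; case.
    case=> e2; apply: (acc_sub Ei Ev).
    apply: (IH j _ (rcons l0 (sep i)) r0); first by rewrite eu' cat_rcons.
    by rewrite cat_rcons e2 (@canon_cat_upd v).
  rewrite eu -[_ ++ r0]/([:: sep i] ++ state q' :: sep i.+1 :: r0) catA => E e.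
  case: (state_split e E) => el eq er; rewrite -eq.
  have e' := e; move: e; rewrite -el -er -catA => /(canon_split ik)[e1].
  case Ev: (v i) => [|x] //= _.
  apply: (acc_zero Ei Ev).
  apply: (IH z _ (rcons l0 (sep i)) (sep i.+1 :: r0)).
    by rewrite eu' cat_rcons.
  by rewrite -e' -el -er cats1.
Qed.

Lemma red_acceptsE q v : red (canon v ++ [:: state q]) <-> accepts P q v.
Proof.
split=> [H|H]; first by apply: (red_accepts H erefl); rewrite cats0.
by apply: (accepts_red H); rewrite cats0.
Qed.

End Simulation.

(** * The diagonal machine *)

Lemma accepts_ext P q v v' : v =1 v' -> accepts P q v -> accepts P q v'.
Proof.
move=> + H; elim: H v' => {q v}.
- by move=> v v' _; apply: acc_end.
- move=> q v r m j E _ IH v' e; apply: acc_add E _; apply: IH => i.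
  by rewrite /upd !e.
- move=> q v r j k x E Ev _ IH v' e; apply: (acc_sub (x := x) E); first by rewrite -e.
  by apply: IH => i; rewrite /upd e.
- move=> q v r j k E Ev _ IH v' e; apply: (acc_zero E); first by rewrite -e.
  exact: IH.
Qed.

Lemma onth_size (T : Type) (s : seq T) : onth s (size s) = None.
Proof. exact: onth_default. Qed.

(** The machine is deterministic, so a step can also be inverted; stated as equivalences, such steps
    let programs be run by rewriting. *)
Lemma accepts_addE P q v r m j v' :
  onth P q = Some (Add r m j) -> upd v r (v r + m) =1 v' ->
  accepts P q v <-> accepts P j v'.
Proof.
move=> E e; split=> [H|H]; last first.
  by apply: acc_add E _; apply: accepts_ext H => i; rewrite e.
apply: accepts_ext e _; case: H E => {q v}.
- by move=> v; rewrite onth_size.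
- by move=> q v ? ? ? -> H [<- <- <-].
- by move=> q v ? ? ? ? ->.
- by move=> q v ? ? ? ->.
Qed.

Lemma accepts_subE P q v r j k x v' :
  onth P q = Some (Sub r j k) -> v r = x.+1 -> upd v r x =1 v' ->
  accepts P q v <-> accepts P j v'.
Proof.
move=> E Ev e; split=> [H|H]; last first.
  by apply: (acc_sub E Ev); apply: accepts_ext H => i; rewrite e.
apply: accepts_ext e _; case: H E Ev => {q v}.
- by move=> v; rewrite onth_size.
- by move=> q v ? ? ? ->.
- by move=> q v ? ? ? ? -> Ev H [? ? ?]; subst; rewrite Ev => -[<-].
- by move=> q v ? ? ? -> Ev H [? ? ?]; subst; rewrite Ev.
Qed.

Lemma accepts_zeroE P q v r j k :
  onth P q = Some (Sub r j k) -> v r = 0 -> accepts P q v <-> accepts P k v.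
Proof.
move=> E Ev; split=> [H|]; last exact: acc_zero E Ev.
case: H E Ev => {q v}.
- by move=> v; rewrite onth_size.
- by move=> q v ? ? ? ->.
- by move=> q v ? ? ? ? -> Ev H [? ? ?]; subst; rewrite Ev.
- by move=> q v ? ? ? -> Ev H [? ? ?]; subst.
Qed.

Lemma accepts_outside P q v : size P < q -> ~ accepts P q v.
Proof.
move=> sq H; case: H sq => {q v} [v|q v r m j E|q v r j k x E|q v r j k E].
- by rewrite ltnn.
all: by move=> *; have := onthTE P q; rewrite E /=; lia.
Qed.

(** The effect on [CodeSeq.code] of putting the letter [a] in front of a word with code [m]. *)
Definition code_cons (a m : nat) : nat := 2 ^ a * m.*2.+1.

Lemma code_nseq n a s :
  CodeSeq.code (nseq n a ++ s) = iter n (code_cons a) (CodeSeq.code s).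
Proof. by elim: n => //= n <-. Qed.

(* With input x, lines 0-11 put code_cons 11 (iter x (code_cons 10) x) in
   register 0, registers 1, 2 and 3 serving as loop counter, accumulator and
   scratch; they are 0 again at line 12. *)
Definition prelude : seq ginstr :=
  [:: Sub 0 1 3; Add 1 1 2; Add 2 1 0;
      Sub 1 4 9; Sub 2 5 6; Add 3 (2 ^ 11) 4; Add 3 (2 ^ 10) 7;
      Sub 3 8 3; Add 2 1 7;
      Sub 2 10 11; Add 0 (2 ^ 12) 9; Add 0 (2 ^ 11) 12].

(** The prelude takes 12 lines, and [minn] sends every halting line of [M] to the final test. *)
Definition embed_line (M : program) (q : nat) : nat := 12 + minn q (size M).

Definition embed_instr (M : program) (i : instr) : ginstr :=
  match i with
  | Inc r j => Add r 1 (embed_line M j)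
  | Dec r j k => Sub r (embed_line M j) (embed_line M k)
  end.

(* The last line accepts on 0; otherwise it jumps outside the program. *)
Definition diagonal (M : program) : seq ginstr :=
  prelude ++ map (embed_instr M) M ++ [:: Sub 0 (14 + size M) (13 + size M)].

Lemma size_diagonal M : size (diagonal M) = 13 + size M.
Proof. by rewrite /diagonal !size_cat size_map /= addn1. Qed.

Definition regs (a b c d : nat) : nat -> nat := nth 0 [:: a; b; c; d].

(** * Runs of the diagonal machine *)

Section Diagonal.

Variable M : program.
Notation acc := (accepts (diagonal M)).


(** The input is copied twice, as loop counter and as accumulator: this is the self-application of
    the diagonal argument. *)
Lemma acc_copy x b c :
  acc 0 (regs x b c 0) <-> acc 3 (regs 0 (b + x) (c + x) 0).
Proof.
elim: x b c => [|x IH] b c.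
  by rewrite !addn0; apply: (accepts_zeroE (r := 0) (j := 1)).
rewrite !addnS -!addSn -IH.
rewrite (@accepts_subE _ _ _ 0 1 3 x (regs x b c 0)) //; last by do 4!case=> //.
rewrite (@accepts_addE _ _ _ 1 1 2 (regs x b.+1 c 0)) //; last first.
  by case=> [|[|[|[|?]]]] //; rewrite /upd /= addn1.
apply: (@accepts_addE _ _ _ 2 1 0) => //.
by case=> [|[|[|[|?]]]] //; rewrite /upd /= addn1.
Qed.

(** Since [code_cons 10 c] is [c * 2 ^ 11 + 2 ^ 10], this loop supplies the product and one further
    addition the constant. *)
Lemma acc_scale b c d :
  acc 4 (regs 0 b c d) <-> acc 6 (regs 0 b 0 (d + c * 2 ^ 11)).
Proof.
elim: c d => [|c IH] d.
  by rewrite mul0n addn0; apply: (accepts_zeroE (r := 2) (j := 5)).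
rewrite mulSn addnA -IH.
rewrite (@accepts_subE _ _ _ 2 5 6 c (regs 0 b c d)) //; last by do 4!case=> //.
by apply: (@accepts_addE _ _ _ 3 (2 ^ 11) 4) => //; case=> [|[|[|[|?]]]].
Qed.

Lemma acc_back b c d : acc 7 (regs 0 b c d) <-> acc 3 (regs 0 b (c + d) 0).
Proof.
elim: d c => [|d IH] c.
  by rewrite addn0; apply: (accepts_zeroE (r := 3) (j := 8)).
rewrite addnS -addSn -IH.
rewrite (@accepts_subE _ _ _ 3 8 3 d (regs 0 b c d)) //; last by do 4!case=> //.
apply: (@accepts_addE _ _ _ 2 1 7) => //.
by case=> [|[|[|[|?]]]] //; rewrite /upd /= addn1.
Qed.

Lemma acc_iter b c :
  acc 3 (regs 0 b c 0) <-> acc 9 (regs 0 0 (iter b (code_cons 10) c) 0).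
Proof.
elim: b c => [|b IH] c.
  by apply: (accepts_zeroE (r := 1) (j := 4)).
rewrite iterSr -IH.
rewrite (@accepts_subE _ _ _ 1 4 9 b (regs 0 b c 0)) //; last by do 4!case=> //.
rewrite acc_scale add0n.
rewrite (@accepts_addE _ _ _ 3 (2 ^ 10) 7 (regs 0 b 0 (code_cons 10 c))) //.
  exact: acc_back.
case=> [|[|[|[|?]]]] //; rewrite /upd /regs /= /code_cons.
by rewrite mulnS -mul2n mulnA -expnSr addnC mulnC.
Qed.

Lemma acc_last a c :
  acc 9 (regs a 0 c 0) <-> acc 11 (regs (a + c * 2 ^ 12) 0 0 0).
Proof.
elim: c a => [|c IH] a.
  by rewrite mul0n addn0; apply: (accepts_zeroE (r := 2) (j := 10)).
rewrite mulSn addnA -IH.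
rewrite (@accepts_subE _ _ _ 2 10 11 c (regs a 0 c 0)) //; last by do 4!case=> //.
by apply: (@accepts_addE _ _ _ 0 (2 ^ 12) 9) => //; case=> [|[|[|[|?]]]].
Qed.

Lemma acc_prelude x :
  acc 0 (upd (fun=> 0) 0 x) <->
  acc 12 (upd (fun=> 0) 0 (code_cons 11 (iter x (code_cons 10) x))).
Proof.
have e y : upd (fun=> 0) 0 y =1 regs y 0 0 0 by do 4!case=> //; case.
have accE q y : acc q (upd (fun=> 0) 0 y) <-> acc q (regs y 0 0 0).
  by split; apply: accepts_ext => // i; rewrite e.
rewrite !accE acc_copy !add0n acc_iter acc_last add0n.
apply: (@accepts_addE _ _ _ 0 (2 ^ 11) 12) => //.
case=> [|[|[|[|?]]]] //; rewrite /upd /regs /= /code_cons.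
by rewrite mulnS -mul2n mulnA -expnSr addnC mulnC.
Qed.

Lemma onth_diagonal q :
  onth (diagonal M) (12 + q) =
  if q < size M then omap (embed_instr M) (onth M q)
  else onth [:: Sub 0 (14 + size M) (13 + size M)] (q - size M).
Proof.
rewrite onth_cat -[size prelude]/12 ltnNge leq_addr addKn onth_cat size_map.
by rewrite onth_map.
Qed.

(** [M] and its embedding move in lockstep; on a halting line [step] is the identity. *)
Lemma acc_step c :
  acc (embed_line M c.1) c.2 <->
  acc (embed_line M (step M c).1) (step M c).2.
Proof.
case: c => q v /=; case E: (onth M q) => [i|] //.
have qM : q < size M by rewrite -onthTE E.
have Ed : onth (diagonal M) (embed_line M q) = Some (embed_instr M i).
  by rewrite /embed_line (minn_idPl (ltnW qM)) onth_diagonal qM E.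
case: i E Ed => [r j|r j k] E Ed.
  by apply: accepts_addE Ed _ => x; rewrite addn1.
case Ev: (v r) => [|x]; first exact: accepts_zeroE Ed Ev.
exact: accepts_subE Ed Ev _.
Qed.

Lemma acc_iter_step t c :
  acc (embed_line M c.1) c.2 <->
  acc (embed_line M (iter t (step M) c).1) (iter t (step M) c).2.
Proof. by elim: t => //= t ->; apply: acc_step. Qed.

(** On zero the jump leads to the size of the program, hence to acceptance; otherwise it leads one
    line past it. *)
Lemma acc_exit v : acc (12 + size M) v <-> v 0 = 0.
Proof.
have E : onth (diagonal M) (12 + size M) = Some (Sub 0 (14 + size M) (13 + size M)).
  by rewrite onth_diagonal ltnn subnn.
case Ev: (v 0) => [|x].
  rewrite (accepts_zeroE E Ev) -size_diagonal.
  by split=> // _; apply: acc_end.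
rewrite (accepts_subE E Ev (fun=> erefl)); split=> //.
by move=> /accepts_outside []; rewrite size_diagonal.
Qed.

Lemma acc_computes x y :
  computes M (code_cons 11 (iter x (code_cons 10) x)) y ->
  acc 0 (upd (fun=> 0) 0 x) <-> y = 0.
Proof.
case=> t; case E: (iter _ _ _) => [q v] [qM <-]; rewrite acc_prelude.
have := acc_iter_step t (0, upd (fun=> 0) 0 (code_cons 11 (iter x (code_cons 10) x))).
rewrite E /= /embed_line min0n (minn_idPr qM) => ->.
exact: acc_exit.
Qed.

End Diagonal.

(** * Codes of machine sequents and the contradiction *)

Definition nregs (P : seq ginstr) : nat := (foldr maxn 0 (map reg P)).+1.

Lemma reg_lt_nregs P : all (fun i => reg i < nregs P) P.
Proof.
rewrite /nregs; elim: P => //= i P IH; rewrite ltnS leq_maxl /=.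
apply: sub_all IH => j; rewrite !ltnS => /leq_trans; apply; exact: leq_maxr.
Qed.

Definition machine_sequent (P : seq ginstr) (x : nat) : sequent :=
  rules_sequent (machine_rules P (nregs P)) (state (size P))
    (canon (nregs P) (upd (fun=> 0) 0 x) ++ [:: state 0]).

Lemma derivable_machine P x :
  derivable (machine_sequent P x).1 (machine_sequent P x).2 <->
  accepts P 0 (upd (fun=> 0) 0 x).
Proof.
by rewrite derivable_reduces red_acceptsE //; apply: reg_lt_nregs.
Qed.

(** The word starts with [sep 0] and [x] units, that is variables 1 and 0, written as the letters 11
    and 10; everything after them is independent of [x]. *)
Lemma machine_sequent_code P : exists c, forall x,
  sequent_code (machine_sequent P x) =
  code_cons 11 (iter x (code_cons 10) c).
Proof.
pose R := machine_rules P (nregs P).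
pose tail : sequent := (wmeta (after (nregs P) (fun=> 0) 0 ++ [:: state 0]) ++
  bangs (map rule_formula R), goal R (state (size P))).
exists (sequent_code tail) => x.
rewrite /sequent_code -code_nseq.
suff -> : sequent_word (machine_sequent P x) = 11 :: nseq x 10 ++ sequent_word tail by [].
rewrite /machine_sequent (@canonE _ _ 0) // after_upd /tail.
set t := after _ _ _; rewrite /sequent_word /= /upd /= -catA.
congr (_ :: _); rewrite /wmeta !map_cat !flatten_cat -!catA; congr (_ ++ _).
by elim: x => //= x ->.
Qed.

Theorem theorem2 :
  ~ algorithmically_decidable sequent_code
      (fun S : sequent => derivable S.1 S.2).
Proof.
case=> M decM; have [c codeE] := machine_sequent_code (diagonal M).
(* The input is [c], the code of the machine's own tail, so [M] is asked whether the machine accepts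
   that same input. *)
have [b []] := decM (machine_sequent (diagonal M) c).
rewrite codeE => /acc_computes; rewrite derivable_machine.
(* Derivability is equivalent both to [b] and, through acceptance, to [b] being false. *)
by case: b => -> [H1 H2]; [have := H2 isT | have := H1 erefl].
Qed.
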